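(* Let $p=q+1$ and let $\widehat{a}_1,\dots,\widehat{a}_p,\widehat{b}_1,\dots,\widehat{b}_q$ be dual numbers, with no $\Re(\widehat{b}_j)$ in $\{0,-1,-2,\dots\}$, such that $$\Re\bigl(\widehat{b}_1+\cdots+\widehat{b}_q-(\widehat{a}_1+\cdots+\widehat{a}_p)\bigr)>0.$$ Then for every dual number $\widehat{x}$ with $|\widehat{x}|=1$ the generalized dual hypergeometric series $${}_pF_q(\widehat{a}_1,\dots,\widehat{a}_p;\widehat{b}_1,\dots,\widehat{b}_q;\widehat{x})=\sum_{k=0}^\infty\frac{(\widehat{a}_1)_k\cdots(\widehat{a}_p)_k}{(\widehat{b}_1)_k\cdots(\widehat{b}_q)_k}\,\frac{(\widehat{x})^k}{k!}$$ converges absolutely.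
   Context: Dual numbers are $\widehat{x}=x_1+\varepsilon x_2$, $x_1,x_2\in\mathbb{R}$, $\varepsilon^2=0$, forming the commutative ring $\mathbb{R}[\varepsilon]/(\varepsilon^2)$. The real part is $\Re(\widehat{x})=x_1$ and the absolute value is $|\widehat{x}|=|\Re(\widehat{x})|=|x_1|$ (so $|\widehat{x}\widehat{y}|=|\widehat{x}||\widehat{y}|$). A series $\sum A_k$ of dual numbers converges absolutely if $\sum|A_k|<\infty$ with respect to this absolute value. The dual shifted factorial is $(\widehat{a})_0=1$, $(\widehat{a})_k=\widehat{a}(\widehat{a}+1)\cdots(\widehat{a}+k-1)$ for $k\ge1$. *)

(* Defs.v *)
From HB Require Import structures.
From mathcomp Require Import all_boot all_order all_algebra ring.
From mathcomp Require Import all_classical all_reals all_analysis.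

Set Implicit Arguments.
Unset Strict Implicit.
Unset Printing Implicit Defensive.

Import Order.TTheory GRing.Theory Num.Theory.
Import numFieldNormedType.Exports.

Local Open Scope ring_scope.

(* [Dual x1 x2] stands for x1 + eps * x2, with eps ^+ 2 = 0. *)
Record dual (R : Type) : Type := Dual { dre : R; ddu : R }.

Section DualEquality.
Context {R : Type}.

Definition pair_of_dual (x : dual R) : R * R := (dre x, ddu x).
Definition dual_of_pair (u : R * R) : dual R := Dual u.1 u.2.

Lemma pair_of_dualK : cancel pair_of_dual dual_of_pair.
Proof. by case. Qed.

End DualEquality.

HB.instance Definition _ (R : choiceType) :=
  Choice.copy (dual R) (can_type (@pair_of_dualK R)).

Section DualRing.
Context {R : fieldType}.
Implicit Types x y z : dual R.

Definition dzero : dual R := Dual 0 0.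
Definition doner : dual R := Dual 1 0.
Definition dadd x y := Dual (dre x + dre y) (ddu x + ddu y).
Definition dopp x := Dual (- dre x) (- ddu x).
Definition dmul x y :=
  Dual (dre x * dre y) (dre x * ddu y + ddu x * dre y).

Fact daddA : associative dadd.
Proof. by move=> x y z; rewrite /dadd /= !addrA. Qed.
Fact daddC : commutative dadd.
Proof. by move=> x y; rewrite /dadd (addrC (dre x)) (addrC (ddu x)). Qed.
Fact dadd0x : left_id dzero dadd.
Proof. by case=> ? ?; rewrite /dadd /= !add0r. Qed.
Fact daddNx : left_inverse dzero dopp dadd.
Proof. by move=> x; rewrite /dadd /= !addNr. Qed.

HB.instance Definition _ :=
  GRing.isZmodule.Build (dual R) daddA daddC dadd0x daddNx.

Fact dmulA : associative dmul.
Proof. by move=> x y z; rewrite /dmul /=; congr Dual; ring. Qed.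
Fact dmulC : commutative dmul.
Proof. by move=> x y; rewrite /dmul /=; congr Dual; ring. Qed.
Fact dmul1x : left_id doner dmul.
Proof. by case=> ? ?; rewrite /dmul /=; congr Dual; ring. Qed.
Fact dmulDl : left_distributive dmul dadd.
Proof. by move=> x y z; rewrite /dmul /dadd /=; congr Dual; ring. Qed.
Fact doner_neq0 : doner != 0 :> dual R.
Proof. by apply/eqP => -[] /eqP; rewrite oner_eq0. Qed.

HB.instance Definition _ :=
  GRing.Zmodule_isComNzRing.Build (dual R)
    dmulA dmulC dmul1x dmulDl doner_neq0.

(* A dual number is invertible iff its real part is nonzero, and then
   (x1 + eps x2)^-1 = x1^-1 - eps x2 / x1^2. *)
Definition dunit : {pred dual R} := fun x => dre x != 0.
Definition dinv x :=
  if dre x != 0 then Dual (dre x)^-1 (- ddu x / dre x ^+ 2) else x.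

Fact dmulVx : {in dunit, left_inverse 1 dinv *%R}.
Proof.
move=> x; rewrite unfold_in => x0; rewrite /dinv x0.
by congr Dual; rewrite /=; field.
Qed.
Fact dunitPl x y : y * x = 1 -> dunit x.
Proof.
case=> yx _; apply/negP => /eqP x0; move: yx.
by rewrite x0 mulr0 => /esym/eqP; rewrite oner_eq0.
Qed.
Fact dinv_out : {in [predC dunit], dinv =1 id}.
Proof. by move=> x; rewrite inE unfold_in /dinv => /negbTE ->. Qed.

HB.instance Definition _ :=
  GRing.ComNzRing_hasMulInverse.Build (dual R) dmulVx dunitPl dinv_out.

End DualRing.

Section DualSeries.
Context {R : realType}.

Definition dabs (x : dual R) : R := `|dre x|.

Definition dual_abs_cvg (A : nat -> dual R) : Prop :=
  cvgn (series (fun k => dabs (A k))).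

Definition dual_poch (a : dual R) (k : nat) : dual R :=
  \prod_(i < k) (a + i%:R).

Definition dual_pFq_term (p q : nat) (a : 'I_p -> dual R)
    (b : 'I_q -> dual R) (x : dual R) (k : nat) : dual R :=
  (\prod_(i < p) dual_poch (a i) k) / (\prod_(j < q) dual_poch (b j) k)
  * (x ^+ k / k`!%:R).

End DualSeries.

(* Main.v *)
Require Import Defs.
From mathcomp Require Import all_boot all_order all_algebra.
From mathcomp Require Import all_classical all_reals all_analysis.
From mathcomp Require Import ring lra.
From mathcomp Require polyrcf.

(** The absolute value of a dual number only sees its real part, so it is
    multiplicative and the claim concerns the nonnegative real sequence
    [u k = dabs (dual_pFq_term a b x k)].  Since [|x| = 1], this sequence
    satisfies
      [u (k + 1) / u k = prod_i |k + a_i| / ((k + 1) * prod_j |k + b_j|)],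
    where [a_i], [b_j] now stand for the real parts, and for large [k] all the
    absolute values can be dropped.

    The ratio tends to 1, so the convergence is decided at the next order, by
    Raabe's test ([raabe_series_cvg]): it is enough to find [d > 0] such that
    [(k + 1 + d) * u (k + 1) <= k * u k] for large [k].  Cleared of
    denominators, this is
      [(k + 1 + d) * prod_i (k + a_i) <= (k + 0) * (k + 1) * prod_j (k + b_j)].
    As [p = q + 1], both sides are monic polynomials in [k] of the same degree
    [q + 2], split into linear factors; their next coefficients are
    [1 + d + sum_i a_i] and [1 + sum_j b_j].  Hence the inequality holds for
    large [k] as soon as [d < sum_j b_j - sum_i a_i] ([prodD_eventually_le]),
    and the hypothesis on the parameters leaves room for such a [d > 0]. *)

Set Implicit Arguments.
Unset Strict Implicit.
Unset Printing Implicit Defensive.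

Import Order.TTheory GRing.Theory Num.Theory.
Import numFieldNormedType.Exports.

Local Open Scope classical_set_scope.
Local Open Scope ring_scope.

(** The hypothesis says that [v k := k * u k] satisfies
    [d * u k.+1 <= v k - v k.+1]; summing it telescopes and bounds the partial
    sums of [u] by a constant plus [v N / d]. *)
Lemma raabe_series_cvg (R : realType) (u : nat -> R) (d : R) :
    0 < d -> (forall k, 0 <= u k) ->
    (\forall k \near \oo, (k.+1%:R + d) * u k.+1 <= k%:R * u k) ->
  cvgn (series u).
Proof.
move=> d0 u0 [N _ hN].
have tele n : (N <= n)%N ->
    d * \sum_(N.+1 <= k < n.+1) u k <= N%:R * u N - n%:R * u n.
  elim: n => [|n IHn].
    by rewrite leqn0 => /eqP ->; rewrite big_geq // mulr0 subrr.
  rewrite leq_eqVlt => /orP[/eqP <-|]; first by rewrite big_geq // mulr0 subrr.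
  rewrite ltnS => leNn; rewrite big_nat_recr //= mulrDr.
  have := hN n leNn; have := IHn leNn; rewrite mulrDl; lra.
rewrite -(is_cvg_series_restrict N.+1).
apply: nondecreasing_is_cvgn.
  apply/nondecreasing_seqP => n.
  have [leNn|ltnN] := leqP N.+1 n; last first.
    by rewrite /= [leLHS]big_geq ?sumr_ge0 // ltnW.
  by rewrite [leRHS]big_nat_recr //= lerDl.
exists (N%:R * u N / d) => _ [n _ <-].
rewrite ler_pdivlMr // mulrC /=.
case: n => [|n]; first by rewrite big_geq // mulr0 mulr_ge0.
have [leNn|ltnN] := leqP N n; last by rewrite big_geq ?mulr0 ?mulr_ge0 // ltnW.
apply: le_trans (tele n leNn) _.
by rewrite gerBl mulr_ge0.
Qed.

(** The two sides are monic polynomials of degree [size r] in [k], so the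
    leading terms cancel and the coefficients in degree [(size r).-1], which
    are the sums of the shifts, decide. *)
Lemma prodD_eventually_le (R : realType) (r s : seq R) :
    size r = size s -> \sum_(c <- r) c < \sum_(c <- s) c ->
  \forall k \near \oo,
    \prod_(c <- r) (k%:R + c) <= \prod_(c <- s) (k%:R + c).
Proof.
move=> rs lt_rs.
pose P (t : seq R) : {poly R} := \prod_(c <- map -%R t) ('X - c%:P).
have PE t y : (P t).[y] = \prod_(c <- t) (y + c).
  rewrite /P big_map horner_prod; apply: eq_bigr => c _.
  by rewrite hornerXsubC opprK.
have sP t : size (P t) = (size t).+1 by rewrite size_prod_XsubC size_map.
have lP t : (P t)`_(size t) = 1.
  have /monicP := monic_prod_XsubC (map -%R t) xpredT id.
  by rewrite lead_coefE -/(P t) sP.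
have nP t : size t != 0 -> (P t)`_(size t).-1 = \sum_(c <- t) c.
  move=> t0; have := @coefPn_prod_XsubC _ (map -%R t).
  rewrite size_map => /(_ t0); rewrite /P => ->.
  by rewrite big_map sumrN opprK.
have s0 : size s != 0.
  apply/eqP => s0; move: lt_rs.
  by rewrite (size0nil s0) (size0nil (etrans rs s0)) ltxx.
pose D := P s - P r.
have Dn : D`_(size s).-1 = \sum_(c <- s) c - \sum_(c <- r) c.
  by rewrite coefB nP // -rs nP // rs.
have sD : size D = size s.
  apply/eqP; rewrite eqn_leq; apply/andP; split.
    apply/leq_sizeP => j; rewrite leq_eqVlt => /orP[/eqP <-|lt_sj].
      by rewrite coefB lP -rs lP subrr.
    by rewrite coefB !nth_default ?subr0 // sP // rs.
  rewrite leqNgt; apply/negP => ltD; move: Dn.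
  rewrite nth_default; last by move: s0 ltD; case: (size s).
  lra.
have lD : 0 < lead_coef D by rewrite lead_coefE sD Dn subr_gt0.
have [y hy] := polyrcf.poly_pinfty_gt_lc lD.
near=> k.
have := lt_le_trans lD (hy k%:R _).
rewrite /D hornerD hornerN !PE subr_gt0 => lt; apply/ltW/lt.
by apply/ltW; near: k; exact: nbhs_infty_gtr.
Unshelve. all: by end_near. Qed.

Lemma dabs1 (R : realType) : dabs (1 : dual R) = 1.
Proof. exact: normr1. Qed.

Lemma dabsM (R : realType) (x y : dual R) : dabs (x * y) = dabs x * dabs y.
Proof. exact: normrM. Qed.

(** Holds for every [x]: when the real part vanishes, [x^-1 = x] also has
    absolute value [0 = 0^-1]. *)
Lemma dabsV (R : realType) (x : dual R) : dabs x^-1 = (dabs x)^-1.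
Proof.
rewrite /dabs -[x^-1]/(Defs.dinv x) /Defs.dinv.
have [x0|_] := eqVneq (dre x) 0 => /=; last exact: normfV.
by rewrite x0 normr0 invr0.
Qed.

Lemma dabs_prod (R : realType) (I : Type) (r : seq I) (F : I -> dual R) :
  dabs (\prod_(i <- r) F i) = \prod_(i <- r) dabs (F i).
Proof. exact: (big_morph _ (@dabsM R) (dabs1 R)). Qed.

Lemma dre_sum (R : realType) (I : Type) (r : seq I) (F : I -> dual R) :
  dre (\sum_(i <- r) F i) = \sum_(i <- r) dre (F i).
Proof. exact: (big_morph (@dre R)). Qed.

Lemma dre_nat (R : realType) (n : nat) : dre (n%:R : dual R) = n%:R.
Proof. by elim: n => // n IHn; rewrite -!natr1 /= IHn. Qed.

Lemma dabs_pochS (R : realType) (a : dual R) (k : nat) :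
  dabs (dual_poch a k.+1) = dabs (dual_poch a k) * `|k%:R + dre a|.
Proof.
by rewrite /dual_poch big_ord_recr dabsM {2}/dabs /= dre_nat (addrC (dre a)).
Qed.

Lemma dabs_pFq_termS (R : realType) (p q : nat) (a : 'I_p -> dual R)
    (b : 'I_q -> dual R) (x : dual R) (k : nat) :
  dabs (dual_pFq_term a b x k.+1) =
  dabs (dual_pFq_term a b x k) * dabs x
  * (\prod_(i < p) `|k%:R + dre (a i)|
     / (k.+1%:R * \prod_(j < q) `|k%:R + dre (b j)|)).
Proof.
have dabs_nat n : dabs (n%:R : dual R) = n%:R by rewrite /dabs dre_nat normr_nat.
rewrite /dual_pFq_term exprS factS natrM !(dabsM, dabsV) !dabs_nat !dabs_prod.
under eq_bigr do rewrite dabs_pochS.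
under [X in _ / X]eq_bigr do rewrite dabs_pochS.
rewrite !big_split /= !invfM; ring.
Qed.

Theorem theorem6p1 (R : realType) (p q : nat) (hpq : p = q.+1)
    (a : 'I_p -> dual R) (b : 'I_q -> dual R)
    (hb : forall (j : 'I_q) (n : nat), dre (b j) <> - n%:R)
    (hab : 0 < dre (\sum_(j < q) b j - \sum_(i < p) a i))
    (x : dual R) (hx : dabs x = 1) :
  dual_abs_cvg (dual_pFq_term a b x).
Proof.
have {}hab : 0 < \sum_(j < q) dre (b j) - \sum_(i < p) dre (a i).
  by rewrite -!dre_sum.
set s := _ - _ in hab.
apply: (@raabe_series_cvg _ _ (s / 2)) => [|k|]; first by rewrite divr_gt0.
  exact: normr_ge0.
have eventually_pos n (c : 'I_n -> dual R) :
    \forall k \near \oo, forall i, 0 < k%:R + dre (c i).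
  apply: filter_forall => i; near=> k.
  by rewrite -ltrBlDr sub0r; near: k; exact: nbhs_infty_gtr.
(* The shifts of the two sides of Raabe's inequality. *)
pose r := 1 + s / 2 :: [seq dre (a i) | i : 'I_p].
pose t := [:: 0, 1 & [seq dre (b j) | j : 'I_q]].
have size_rt : size r = size t by rewrite /= !size_image !card_ord hpq.
have sum_rt : \sum_(c <- r) c < \sum_(c <- t) c.
  rewrite !big_cons !big_image /= add0r -addrA ltrD2l -ltrBrDr -/s.
  by rewrite ltr_pdivrMr // ltr_pMr // ltr1n.
near=> k.
have k0 : 0 < k%:R :> R by near: k; exact: nbhs_infty_gtr.
have a0 : forall i, 0 < k%:R + dre (a i) by near: k; exact: eventually_pos.
have b0 : forall j, 0 < k%:R + dre (b j) by near: k; exact: eventually_pos.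
have : \prod_(c <- r) (k%:R + c) <= \prod_(c <- t) (k%:R + c).
  by near: k; exact: prodD_eventually_le.
rewrite !big_cons !big_image /= addr0 addrA natr1 => le_rt.
rewrite dabs_pFq_termS hx mulr1 mulrCA [leRHS]mulrC.
apply: ler_wpM2l; first exact: normr_ge0.
under eq_bigr do rewrite gtr0_norm //.
under [X in _ / (_ * X)]eq_bigr do rewrite gtr0_norm //.
rewrite mulrA ler_pdivrMr //.
by rewrite mulr_gt0 ?ltr0n // prodr_gt0.
Unshelve. all: by end_near. Qed.
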